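(* There exist constants $c>0$ and $N_0$ such that for all $N\ge N_0$ and all positive integers $m,p,H,D$: if some $f\in\mathcal{TG}^{D,H}_{N,m,1,p}$ (a standard, i.e. second-order, graph transformer) satisfies $f(X)=\mathrm{DirectedCycle3}(X)$ for all $X\in\{0,1\}^{N\times N}$, then $mpHD\ge cN/\log^2N$.
   Context: The input $X\in\{0,1\}^{N\times N}$ is the adjacency matrix of a directed graph on $[N]=\{1,\dots,N\}$, $x_{i,j}=1$ iff $(i,j)$ is an edge; row $x_i$ is the embedding of vertex $i$. $\mathrm{DirectedCycle3}(X)\in\{0,1\}^N$ is given by $\mathrm{DirectedCycle3}(X)_i=1$ if there exist $j_1,j_2\in[N]$ with $x_{i,j_1}x_{j_1,j_2}x_{j_2,i}=1$, and $0$ otherwise. Graph self-attention (second order). Let $X$ be the adjacency matrix given as input to the whole network and $Y\in\mathbb{R}^{N\times d}$ the current sequence of embeddings. For $Q,K\in\mathbb{R}^{d\times m}$, $V\in\mathbb{R}^{d\times d'}$ encoded with $p$-bit fixed-point numbers and a function $\kappa:\{0,1\}^2\times\mathbb{R}\to\mathbb{R}$, a graph self-attention unit outputs $\mathrm{softmax}(\kappa(X,YQK^{\mathsf T}Y^{\mathsf T}))\,YV\in\mathbb{R}^{N\times d'}$, where $\kappa(X,A)_{i,j}=\kappa(x_{i,j},x_{j,i},A_{i,j})$ and softmax is row-wise: $\mathrm{softmax}(A)_{i,j}=\exp(A_{i,j})/\sum_{j'}\exp(A_{i,j'})$. An $H$-headed layer is a sum of $H$ such units. MLP layer. $\Phi_{d,d',p}$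 is the set of all (arbitrary) functions $\phi:\mathbb{R}^d\to\mathbb{R}^{d'}$ whose real-valued inputs and outputs can be represented using $p$-bit fixed-precision numbers, applied row-wise. $\mathcal{TG}^{D,H}_{d,m,d',p}$ is the set of graph transformers of depth $D$: compositions of $D$ blocks, each an MLP layer (from $\Phi_{d,m,p}$ in the first block, $\Phi_{m,m,p}$ in later ones) followed by an $H$-headed graph self-attention layer with input, embedding and output dimensions all $m$, followed by a final output MLP in $\Phi_{m,d',p}$. *)

(* Defs.v *)
From mathcomp Require Import all_boot all_order all_algebra.
From mathcomp Require Import reals sequences exp.

Set Implicit Arguments.
Unset Strict Implicit.
Unset Printing Implicit Defensive.
Import Order.TTheory GRing.Theory Num.Theory.
Local Open Scope ring_scope.

(** A directed graph on [N] is its adjacency matrix [X : 'M[bool]_N]; loops are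
    allowed, and [i], [j1], [j2] below need not be distinct. *)
Definition directed_cycle3 (R : realType) (N : nat) (X : 'M[bool]_N) : 'cV[R]_N :=
  \col_i [exists j1, exists j2, [&& X i j1, X j1 j2 & X j2 i]]%:R.

Section FixedPoint.
Variable R : realType.

(** [p] magnitude bits (the sign is not counted), [s] of them fractional, so
    that 0 and 1 are representable as soon as [s < p]. *)
Definition fixed_point (p s : nat) (x : R) : Prop :=
  exists2 k : int, `|k| < 2 ^+ p & x = k%:~R / 2 ^+ s.

Definition fixed_point_mx (p s a b : nat) (A : 'M[R]_(a, b)) : Prop :=
  forall i j, fixed_point p s (A i j).

(** [z] is a [p]-bit representation of the real [x] (faithful rounding): it is
    the only [p]-bit number on the closed segment joining [x] to [z].  Thus
    [z = x] if [x] is a [p]-bit number, [z] is one of the two neighbours of [x]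
    if [x] lies strictly between two consecutive [p]-bit numbers, and [z] is the
    extreme [p]-bit number if [x] is out of range. *)
Definition rounds_to (p s : nat) (x z : R) : Prop :=
  fixed_point p s z /\
  forall w, fixed_point p s w -> Num.min x z <= w <= Num.max x z -> w = z.

Definition rounds_to_mx (p s a b : nat) (A Z : 'M[R]_(a, b)) : Prop :=
  forall i j, rounds_to p s (A i j) (Z i j).

Lemma rounds_to_id (p s : nat) (x z : R) :
  fixed_point p s x -> rounds_to p s x z <-> z = x.
Proof.
move=> fx; split=> [[_ /(_ x fx)] -> //|->].
  by rewrite ge_min le_max lexx.
by split=> // w _; rewrite minxx maxxx => /le_anti.
Qed.

Lemma rounds_to_total (p s : nat) (x : R) : exists z, rounds_to p s x z.
Proof.
pose v (k : 'I_(2 ^ p).*2) : int := k%:Z - (2 ^ p)%:Z.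
pose F k : R := (v k)%:~R / 2 ^+ s.
have E2 : 2 ^+ p = (2 ^ p)%:Z by rewrite -natrX natz.
have lt0 : (2 ^ p < (2 ^ p).*2)%N by rewrite -addnn -addn1 leq_add2l expn_gt0.
pose P k := `|v k| < 2 ^+ p.
have P0 : P (Ordinal lt0) by rewrite /P /v subrr normr0 exprn_gt0.
case: (@arg_minP _ _ _ (Ordinal lt0) P (fun k => `|x - F k|) P0) => k Pk kmin.
exists (F k); split; first by exists (v k).
move=> _ [l ltl ->].
have [j Pj ->] : exists2 j, P j & l%:~R / 2 ^+ s = F j.
  move: (ltl); rewrite E2 ltr_norml => /andP[lo hi].
  have ltj : (`|(l + (2 ^ p)%:Z)%R|%N < (2 ^ p).*2)%N.
    by rewrite -ltz_nat gez0_abs -?addnn ?PoszD ?ltrD2r // -lerBlDr sub0r ltW.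
  have vj : v (Ordinal ltj) = l.
    by rewrite /v /= gez0_abs ?addrK // -lerBlDr sub0r ltW.
  by exists (Ordinal ltj); rewrite /P /F vj.
have [xk|/ltW kx] := leP x (F k) => /andP[le_w w_le]; move: (kmin j Pj).
  rewrite ler0_norm ?subr_le0 // ler0_norm ?subr_le0 // lerN2 lerD2l lerN2 => kj.
  by apply/le_anti; rewrite w_le.
rewrite ger0_norm ?subr_ge0 // ger0_norm ?subr_ge0 // lerD2l lerN2 => jk.
by apply/le_anti; rewrite jk.
Qed.

End FixedPoint.

Section Transformer.
Variable R : realType.

Definition softmax (a b : nat) (A : 'M[R]_(a, b)) : 'M[R]_(a, b) :=
  \matrix_(i, j) (expR (A i j) / \sum_j' expR (A i j')).

Record attention_unit (d m d' : nat) := AttentionUnit {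
  query : 'M[R]_(d, m);
  key : 'M[R]_(d, m);
  value : 'M[R]_(d, d');
  kappa : bool -> bool -> R -> R }.

Definition attention_params_fixed (p s d m d' : nat) (u : attention_unit d m d') :=
  [/\ fixed_point_mx p s (query u), fixed_point_mx p s (key u)
    & fixed_point_mx p s (value u)].

Definition kappa_mx (N : nat) (kap : bool -> bool -> R -> R) (X : 'M[bool]_N)
    (A : 'M[R]_N) : 'M[R]_N :=
  \matrix_(i, j) kap (X i j) (X j i) (A i j).

Definition graph_attention (N d m d' : nat) (X : 'M[bool]_N)
    (u : attention_unit d m d') (Y : 'M[R]_(N, d)) : 'M[R]_(N, d') :=
  softmax (kappa_mx (kappa u) X (Y *m query u *m (key u)^T *m Y^T))
    *m (Y *m value u).

Definition multihead_attention (N H d m d' : nat) (X : 'M[bool]_N)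
    (u : 'I_H -> attention_unit d m d') (Y : 'M[R]_(N, d)) : 'M[R]_(N, d') :=
  \sum_(h < H) graph_attention X (u h) Y.

(** An element of [Phi_{d,d',p}] is an arbitrary map between [p]-bit vectors;
    only its values at [p]-bit vectors are constrained, or ever used. *)
Definition is_mlp (p s d d' : nat) (phi : 'rV[R]_d -> 'rV[R]_d') : Prop :=
  forall x, fixed_point_mx p s x -> fixed_point_mx p s (phi x).

Definition apply_rows (N d d' : nat) (phi : 'rV[R]_d -> 'rV[R]_d')
    (Y : 'M[R]_(N, d)) : 'M[R]_(N, d') :=
  \matrix_i phi (row i Y).

Record block (H d m : nat) := Block {
  block_mlp : 'rV[R]_d -> 'rV[R]_m;
  block_heads : 'I_H -> attention_unit m m m }.

Definition is_block (p s H d m : nat) (b : block H d m) : Prop :=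
  is_mlp p s (block_mlp b) /\
  forall h, attention_params_fixed p s (block_heads b h).

(** Attention is computed over the reals, whereas MLPs take [p]-bit inputs: the
    real matrix [Y] entering a block is first represented by a [p]-bit matrix
    [Z].  As the rounding mode is left open, runs are relational. *)
Definition block_run (p s N H d m : nat) (X : 'M[bool]_N) (b : block H d m)
    (Y : 'M[R]_(N, d)) (Y' : 'M[R]_(N, m)) : Prop :=
  exists2 Z, rounds_to_mx p s Y Z &
    Y' = multihead_attention X (block_heads b) (apply_rows (block_mlp b) Z).

Fixpoint blocks_run (p s N H m : nat) (X : 'M[bool]_N) (bs : seq (block H m m))
    (Y Y' : 'M[R]_(N, m)) : Prop :=
  if bs is b :: bs' then
    exists2 Y1, block_run p s X b Y Y1 & blocks_run p s X bs' Y1 Y'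
  else Y' = Y.

Definition network_run (p s N H m d' : nat) (first : block H N m)
    (later : seq (block H m m)) (out : 'rV[R]_m -> 'rV[R]_d')
    (X : 'M[bool]_N) (F : 'M[R]_(N, d')) : Prop :=
  exists Y1 YD Z,
    [/\ block_run p s X first (map_mx (fun b : bool => b%:R) X) Y1,
        blocks_run p s X later Y1 YD,
        rounds_to_mx p s YD Z & F = apply_rows out Z].

(** The class [TG^{D,H}_{N,m,d',p}], the number [s] of fractional bits being part
    of the network.  By [rounds_to_total] every network has a run on every [X],
    hence determines at most one [f]; by [rounds_to_id], if all MLP inputs are
    [p]-bit numbers, the run is unique and [f] is the composition of the layers. *)
Definition graph_transformer (D H N m d' p : nat)
    (f : 'M[bool]_N -> 'M[R]_(N, d')) : Prop :=
  exists (s : nat) (first : block H N m) (later : seq (block H m m))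
         (out : 'rV[R]_m -> 'rV[R]_d'),
    [/\ (size later).+1 = D,
        is_block p s first,
        (forall i : 'I_(size later), is_block p s (tnth (in_tuple later) i)),
        is_mlp p s out
      & forall X F, network_run p s first later out X F -> F = f X].

End Transformer.

(* Main.v *)
Require Import Defs.
From mathcomp Require Import all_boot all_order all_algebra.
From mathcomp Require Import reals sequences exp.
From mathcomp Require Import zify ring lra.

(** Fooling sets. The input is built from two subsets [S] and [T] of a grid
    [n * n], [n = N / 3], so that a 3-cycle through vertex [k] corresponds to some
    [(k, l)] in [S] but not in [T]. Every pair [{i, j}] of vertices is then
    controlled by one of [S] and [T] alone, so each softmax row is a weighted
    average whose weights split into an [S]-part and a [T]-part. Layer by layer we
    pass, by pigeonhole, to a subfamily of subsets such that all the inputs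
    [(S, T)] with [S], [T] in the subfamily admit runs with the same [p]-bit
    embeddings: it suffices to fix the position of the largest weight of each
    softmax row and to fix, up to a small error, the partial sums normalised by that
    weight. A layer costs a factor [2 ^ O(N H m (p + log N))] whereas there are
    [2 ^ (n * n)] subsets, and two subsets that survive until the output have to
    coincide. *)

Set Implicit Arguments.
Unset Strict Implicit.
Unset Printing Implicit Defensive.
Import Order.TTheory GRing.Theory Num.Theory.
Local Open Scope ring_scope.

(** * Pigeonhole principles *)

Lemma pigeonhole (I T : finType) (F : {set I}) (g : I -> T) :
  exists F' : {set I},
    [/\ F' \subset F, (#|F| <= #|F'| * #|T|)%N & {in F' &, forall x y, g x = g y}].
Proof.
have [->|[x0 Fx0]] := set_0Vmem F.
  by exists set0; rewrite sub0set cards0 mul0n; split=> // x y; rewrite inE.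
pose fib t := [set x in F | g x == t].
case: (@arg_maxnP _ (g x0) xpredT (fun t => #|fib t|) isT) => t _ tmax.
exists (fib t); split; first by apply/subsetP=> x; rewrite inE => /andP[].
  rewrite -sum1_card (partition_big g xpredT) //= mulnC -sum_nat_const.
  apply: leq_sum => t' _; rewrite sum1dep_card.
  exact: tmax.
by move=> x y; rewrite !inE => /andP[_ /eqP->] /andP[_ /eqP->].
Qed.

(** Cut [[-B, B]] into [K] cells of equal length and record the cell of every [g j x] at once; the
    value [B] itself needs index [K], whence [K.+1]. *)
Lemma pigeonhole_real (R : realType) (I J : finType) (F : {set I})
    (g : J -> I -> R) (B : R) (K : nat) :
  0 < B -> (0 < K)%N -> (forall j x, `|g j x| <= B) ->
  exists F' : {set I},
    [/\ F' \subset F, (#|F| <= #|F'| * K.+1 ^ #|J|)%N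
      & forall j, {in F' &, forall x y, `|g j x - g j y| <= 2 * B / K%:R}].
Proof.
move=> B0 K0 gB.
pose sc j x := (g j x + B) / (2 * B / K%:R).
have KR : 0 < K%:R :> R by rewrite ltr0n.
have cell0 : 0 < 2 * B / K%:R by rewrite divr_gt0 ?mulr_gt0.
have sc0 j x : 0 <= sc j x.
  by have := gB j x; rewrite ler_norml => /andP[lo _]; apply: divr_ge0 (ltW cell0); lra.
have scK j x : sc j x <= K%:R.
  have := gB j x; rewrite ler_norml => /andP[_ hi].
  by rewrite ler_pdivrMr // mulrCA divff ?gt_eqF // mulr1; lra.
have trK j x : (Num.trunc (sc j x) < K.+1)%N.
  rewrite ltnS -(ler_nat R); have /andP[lo _] := truncn_itv (sc0 j x).
  exact: le_trans lo (scK j x).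
have [F' [sF' cF' eqF']] := pigeonhole F (fun x => [ffun j => Ordinal (trK j x)]).
exists F'; split=> //; first by rewrite card_ffun card_ord in cF'.
move=> j x y Fx Fy; have /ffunP/(_ j) := eqF' x y Fx Fy.
rewrite !ffunE => /(congr1 val)/= eq_tr.
have /andP[lx hx] := truncn_itv (sc0 j x).
have /andP[ly hy] := truncn_itv (sc0 j y); rewrite -eq_tr -natr1 in ly hy *.
rewrite -natr1 in hx.
have -> : g j x - g j y = (sc j x - sc j y) * (2 * B / K%:R).
  by rewrite -mulrBl opprD addrACA subrr addr0 divfK ?gt_eqF.
rewrite normrM (gtr0_norm cell0) ler_piMl ?(ltW cell0) // ler_norml; lra.
Qed.

(** * Rounding to the fixed-point grid *)

Section FixedPointGrid.
Variables (R : realType) (p s : nat).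

Lemma fixed_point_norm (x : R) : fixed_point p s x -> `|x| <= 2 ^+ p / 2 ^+ s.
Proof.
move=> [k kp ->]; rewrite normrM normfV normrX (ger0_norm (ler0n _ 2)).
rewrite ler_wpM2r ?invr_ge0 ?exprn_ge0 // -intr_norm.
have -> : 2 ^+ p = (2 ^+ p : int)%:~R :> R by rewrite rmorphXn.
by rewrite ler_int ltW.
Qed.

Lemma fixed_point_sep (x y : R) :
  fixed_point p s x -> fixed_point p s y -> `|x - y| < 1 / 2 ^+ s -> x = y.
Proof.
move=> [k _ ->] [l _ ->]; rewrite -mulrBl normrM normfV normrX (ger0_norm (ler0n _ 2)).
rewrite ltr_pM2r ?invr_gt0 ?exprn_gt0 // -intrB -intr_norm -[1]/(1%:~R) ltr_int.
by move=> kl; congr (_%:~R / _); lia.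
Qed.

Lemma nearest_fixed_point (x : R) :
  exists2 z, fixed_point p s z & forall w, fixed_point p s w -> `|x - z| <= `|x - w|.
Proof.
(* Sign and magnitude enumerate all [p]-bit numbers (zero twice), so the minimum is over a finite
   type. *)
pose F (k : bool * 'I_(2 ^ p)) : R := ((-1) ^+ k.1 * k.2%:Z)%:~R / 2 ^+ s.
have E2 : 2 ^+ p = (2 ^ p)%:Z by rewrite -natrX natz.
have lt0 : (0 < 2 ^ p)%N by rewrite expn_gt0.
case: (@arg_minP _ _ _ (false, Ordinal lt0) xpredT (fun k => `|x - F k|) isT) => k _ kmin.
exists (F k).
  exists ((-1) ^+ k.1 * k.2%:Z) => //.
  by rewrite normrM normrX normrN1 expr1n mul1r E2 ger0_norm // ltz_nat ltn_ord.
move=> _ [l ltl ->].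
have ltl' : (`|l|%N < 2 ^ p)%N by rewrite -ltz_nat -E2.
apply: le_trans (kmin (l < 0, Ordinal ltl') isT) _.
by rewrite /F /= -intEsign.
Qed.

(* A reconstruction of the input of an MLP with error below half a unit of the
   last place is enough to determine an admissible rounding of the true value. *)
Lemma rounds_to_robust (x0 : R) :
  exists2 z, fixed_point p s z &
    forall x, `|x - x0| < 1 / 2 ^+ s / 2 -> rounds_to p s x z.
Proof.
have [z fz zmin] := nearest_fixed_point x0; exists z => // x xx0.
split=> // w fw; rewrite ge_min le_max => hw.
(* A grid point [w] between [x] and [z], at least one unit from [z], would be closer than [z] to
   [x0], since [x] moves by less than half a unit. *)
apply: fixed_point_sep => //; rewrite ltNge; apply/negP => far.
have := zmin w fw; move: hw far xx0; move: (1 / 2 ^+ s : R) => u.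
by case/andP=> /orP[] ? /orP[] ?; do ![case: ger0P => ?]; lra.
Qed.

End FixedPointGrid.

(** * Perturbation of weighted averages *)

Lemma ratio_close (R : realType) (a a0 n n0 M delta : R) :
  1 <= a -> 1 <= a0 -> `|n0| <= M * a0 ->
  `|a - a0| <= delta -> `|n - n0| <= M * delta ->
  `|n / a - n0 / a0| <= 2 * M * delta.
Proof.
move=> a1 a01 n0M da dn.
have a0' : 0 < a0 by exact: lt_le_trans a01.
have a' : 0 < a by exact: lt_le_trans a1.
have M0 : 0 <= M by rewrite -(pmulr_lge0 _ a0') (le_trans _ n0M).
have q0M : `|n0 / a0| <= M by rewrite normrM normfV (gtr0_norm a0') ler_pdivrMr.
(* The old quotient is bounded by [M], and dividing by [a >= 1] does not enlarge the error. *)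
have -> : n / a - n0 / a0 = ((n - n0) + n0 / a0 * (a0 - a)) / a.
  by field; rewrite !gt_eqF.
rewrite normrM normfV (gtr0_norm a') ler_pdivrMr //.
apply: (@le_trans _ _ (2 * M * delta)).
  apply: le_trans (ler_normD _ _) _; have -> : 2 * M * delta = M * delta + M * delta by ring.
  apply: lerD => //.
  by rewrite normrM (distrC a0) ler_pM.
rewrite ler_peMr // -mulrA mulr_ge0 // mulr_ge0 //.
exact: le_trans da.
Qed.

Section WeightedAverage.
Variables (R : realType) (J : finType).
Implicit Types (w v : J -> R) (d : pred J).

Definition weighted_avg w v := (\sum_j w j * v j) / \sum_j w j.

(** On one row of the input [(S, T)], [d] marks the entries decided by [S]; the others are decided
    by [T]. *)
Definition mix d w w' j := if d j then w j else w' j.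

Lemma sum_mix d w w' v :
  \sum_j mix d w w' j * v j =
  \sum_(j | d j == true) w j * v j + \sum_(j | d j == false) w' j * v j.
Proof.
rewrite (bigID d) /=; congr (_ + _); last first.
  by apply: eq_big => j; rewrite ?eqbF_neg // /mix => /negbTE ->.
by apply: eq_big => j; rewrite ?eqb_id // /mix => ->.
Qed.

Lemma weighted_avg_scale w v e :
  e != 0 -> weighted_avg (fun j => w j / e) v = weighted_avg w v.
Proof.
move=> e0; rewrite /weighted_avg -mulr_suml invfM invrK.
under eq_bigr do rewrite mulrAC.
by rewrite -mulr_suml mulrACA mulVf // mulr1.
Qed.

(** All four weight functions equal 1 at [k], so both denominators are at least 1 whichever side of
    [d] contains [k]. Numerator and denominator each collect two errors, hence [ratio_close] with
    [2 * delta]. *)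
Lemma mixed_avg_close d x y x0 y0 v (k : J) (M delta : R) :
  (forall j, [/\ 0 <= x j, 0 <= y j, 0 <= x0 j & 0 <= y0 j]) ->
  [/\ x k = 1, y k = 1, x0 k = 1 & y0 k = 1] ->
  (forall j, `|v j| <= M) ->
  `|\sum_(j | d j == true) x j - \sum_(j | d j == true) x0 j| <= delta ->
  `|\sum_(j | d j == false) y j - \sum_(j | d j == false) y0 j| <= delta ->
  `|\sum_(j | d j == true) x j * v j - \sum_(j | d j == true) x0 j * v j| <= M * delta ->
  `|\sum_(j | d j == false) y j * v j - \sum_(j | d j == false) y0 j * v j| <= M * delta ->
  `|weighted_avg (mix d x y) v - weighted_avg (mix d x0 y0) v| <= 4 * M * delta.
Proof.
move=> ge0 [xk yk x0k y0k] vM dx dy dxv dyv.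
have sum1 w w' : \sum_j mix d w w' j =
    \sum_(j | d j == true) w j + \sum_(j | d j == false) w' j.
  have := sum_mix d w w' (fun=> 1); do ![under eq_bigr do rewrite mulr1].
  by move->; congr (_ + _); apply: eq_bigr => j _; rewrite mulr1.
have tot1 w w' : (forall j, 0 <= w j /\ 0 <= w' j) -> w k = 1 -> w' k = 1 ->
    1 <= \sum_j mix d w w' j.
  move=> w0 wk wk'; rewrite (bigD1 k) //= {1}/mix wk wk' if_same lerDl sumr_ge0 // => j _.
  by rewrite /mix; case: ifP; case: (w0 j).
have -> : 4 * M * delta = 2 * M * (2 * delta) by ring.
apply: ratio_close.
- by apply: tot1 => // j; case: (ge0 j).
- by apply: tot1 => // j; case: (ge0 j).
- apply: le_trans (ler_norm_sum _ _ _) _; rewrite mulr_sumr ler_sum // => j _.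
  have m0 : 0 <= mix d x0 y0 j by rewrite /mix; case: ifP; case: (ge0 j).
  by rewrite normrM (ger0_norm m0) mulrC ler_wpM2r.
- by rewrite !sum1 opprD addrACA; apply: le_trans (ler_normD _ _) _; lra.
- by rewrite !sum_mix opprD addrACA; apply: le_trans (ler_normD _ _) _; lra.
Qed.

End WeightedAverage.

Lemma graph_attentionE (R : realType) (N d m d' : nat) (X : 'M[bool]_N)
    (u : attention_unit R d m d') (Y : 'M[R]_(N, d)) i c :
  let A := Y *m query u *m (key u)^T *m Y^T in
  graph_attention X u Y i c =
  weighted_avg (fun j => expR (kappa u (X i j) (X j i) (A i j)))
               (fun j => (Y *m value u) j c).
Proof.
move=> A; rewrite /graph_attention mxE /weighted_avg mulr_suml.
apply: eq_bigr => j _; rewrite !mxE mulrAC; congr (_ * _ / _); rewrite ?mxE //.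
by apply: eq_bigr => j' _; rewrite mxE.
Qed.

Lemma fixed_point_mulmx_norm (R : realType) (p s N m d : nat)
    (W : 'M[R]_(N, m)) (V : 'M[R]_(m, d)) i c :
  fixed_point_mx p s W -> fixed_point_mx p s V ->
  `|(W *m V) i c| <= m%:R * (2 ^+ p / 2 ^+ s) ^+ 2.
Proof.
move=> fW fV; rewrite mxE; apply: le_trans (ler_norm_sum _ _ _) _.
apply: le_trans (_ : \sum_(j < m) (2 ^+ p / 2 ^+ s) ^+ 2 <= _); last first.
  by rewrite sumr_const card_ord mulr_natl.
by apply: ler_sum => j _; rewrite normrM expr2 ler_pM // fixed_point_norm.
Qed.

Lemma nonempty_of_card (I : finType) (F F' : {set I}) (k : nat) :
  F != set0 -> (#|F| <= #|F'| * k)%N -> F' != set0.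
Proof.
rewrite -!card_gt0 => F0 cF.
by have := leq_trans F0 cF; rewrite muln_gt0 => /andP[].
Qed.

(** * Fooling families through the layers of a transformer *)

Section FoolingSet.
Variables (R : realType) (p N m H : nat) (I : finType).
Variables (X : I -> I -> 'M[bool]_N) (d : rel 'I_N).
Hypotheses (m_gt0 : (0 < m)%N) (H_gt0 : (0 < H)%N) (N_gt0 : (0 < N)%N).
(** [kappa] reads both [x_ij] and [x_ji]; symmetry of [d] makes the same index decide both. *)
Hypothesis d_sym : symmetric d.
Hypothesis X_entry : forall S T i j, X S T i j = if d i j then X S S i j else X T T i j.

(* Number of cells in which the normalised partial sums are located: their error
   [2 * N / cells] is amplified by [4 * H * m * 2 ^ (2 * p - 2 * s)] in the output
   of the layer, and has to stay below half a unit of the last place, [2 ^ - s / 2]. *)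
Definition cells : nat := (32 * m * H * N * 2 ^ (2 * p))%N.

(** The first factor counts the values of [tag]. The second counts the cells of [stat]: for each
    row, head and side of [d], one sum for the denominator and [m] for the numerators. *)
Definition block_cost : nat :=
  ((N * (2 * 2)) ^ (N * H) * cells.+1 ^ (N * H * 2 * m.+1))%N.

Section Attention.
Variables (s : nat) (u : 'I_H -> attention_unit R m m m) (W : 'M[R]_(N, m)).
Hypothesis u_fixed : forall h, attention_params_fixed p s (u h).
Hypothesis W_fixed : fixed_point_mx p s W.

Let A h := W *m query (u h) *m (key (u h))^T *m W^T.
Let v h c j := (W *m value (u h)) j c.
Let e S T h i j := expR (kappa (u h) (X S T i j) (X S T j i) (A h i j)).
Let M : R := m%:R * (2 ^+ p / 2 ^+ s) ^+ 2.

Let top h i S := [arg max_(j > i) e S S h i j]%O.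
(* Dividing by the largest weight of the row bounds the partial sums, although
   [kappa] is arbitrary and the weights themselves are not bounded. *)
Let w S h i j := e S S h i j / e S S h i (top h i S).

Let M_gt0 : 0 < M.
Proof. by rewrite mulr_gt0 ?ltr0n // exprn_gt0 // divr_gt0 // exprn_gt0. Qed.

Let v_le h c j : `|v h c j| <= M.
Proof. by case: (u_fixed h) => _ _ fv; exact: fixed_point_mulmx_norm. Qed.

Let w_ge0 S h i j : 0 <= w S h i j.
Proof. by rewrite divr_ge0 ?expR_ge0. Qed.

Let w_le1 S h i j : w S h i j <= 1.
Proof.
rewrite ler_pdivrMr ?expR_gt0 // mul1r /top.
by case: arg_maxP => // k _; apply.
Qed.

Let w_top S h i : w S h i (top h i S) = 1.
Proof. by rewrite /w divff // gt_eqF ?expR_gt0. Qed.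

(** With the two adjacency bits at the top position, the largest weight itself is determined, so the
    whole family is normalised by one real number. *)
Let tag S := [ffun q : 'I_N * 'I_H =>
  let k := top q.2 q.1 S in (k, (X S S q.1 k, X S S k q.1))].

Let J : finType := ('I_N * 'I_H * bool * option 'I_m)%type.

(** [None] gives a part of the softmax denominator, [Some c] a part of the numerator of coordinate
    [c], divided by [M] so that every term is at most 1 in absolute value. *)
Let stat (q : J) S : R :=
  let: (i, h, b, o) := q in
  \sum_(j | d i j == b) w S h i j * (if o is Some c then v h c j / M else 1).

Let stat_le q S : `|stat q S| <= N%:R.
Proof.
case: q => [[[i h] b] o]; apply: le_trans (ler_norm_sum _ _ _) _.
apply: (@le_trans _ _ (\sum_(j < N) 1)); last by rewrite sumr_const card_ord.
rewrite big_mkcond; apply: ler_sum => j _; case: ifP => // _.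
rewrite normrM (ger0_norm (w_ge0 _ _ _ _)) mulr_ile1 //.
case: o => [c|]; last by rewrite normr1.
by rewrite normrM normfV (gtr0_norm M_gt0) ler_pdivrMr // mul1r.
Qed.

Lemma attention_fooling (F : {set I}) : F != set0 ->
  exists (F' : {set I}) (Z : 'M[R]_(N, m)),
    [/\ F' \subset F, (#|F| <= #|F'| * block_cost)%N
      & {in F' &, forall S T,
          rounds_to_mx p s (multihead_attention (X S T) u W) Z}].
Proof.
move=> F0.
have K_gt0 : (0 < cells)%N by rewrite /cells !muln_gt0 m_gt0 H_gt0 N_gt0 expn_gt0.
have [F1 [sF1 cF1 tagF1]] := pigeonhole F tag.
have N_pos : 0 < N%:R :> R by rewrite ltr0n.
have [F2 [sF2 cF2 statF2]] := pigeonhole_real F1 N_pos K_gt0 stat_le.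
have cF2' : (#|F| <= #|F2| * block_cost)%N.
  rewrite card_ffun !card_prod !card_ord card_bool in cF1.
  rewrite !card_prod card_option !card_ord card_bool in cF2.
  apply: leq_trans cF1 _.
  by rewrite /block_cost [X in (_ <= _ * X)%N]mulnC [leqRHS]mulnA leq_mul.
have [S0 S0F2] := set0Pn _ (nonempty_of_card F0 cF2').
(* One reference output provides the rounding for all pairs; it remains to bring every other output
   within half a unit of it. *)
pose Y0 := multihead_attention (X S0 S0) u W.
have [z _ z_round] := fin_all_exists2
  (fun q : 'I_N * 'I_m => rounds_to_robust p s (Y0 q.1 q.2)).
exists F2, (\matrix_(i, c) z (i, c)); split=> //; first exact: subset_trans sF1.
move=> S T SF2 TF2 i c; rewrite mxE; apply: (z_round (i, c)) => /=.
rewrite /Y0 /multihead_attention !summxE -sumrB.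
have wE S' h j : w S' h i j = e S' S' h i j / e S' S' h i (top h i S') by [].
clearbody w; pose delta : R := 2 * N%:R / cells%:R.
have head_close h : `|graph_attention (X S T) (u h) W i c -
    graph_attention (X S0 S0) (u h) W i c| <= 4 * M * delta.
  have top_eq S' : S' \in F2 -> [/\ top h i S' = top h i S0,
      X S' S' i (top h i S0) = X S0 S0 i (top h i S0) &
      X S' S' (top h i S0) i = X S0 S0 (top h i S0) i].
    move=> S'F2; have /ffunP/(_ (i, h)) := tagF1 _ _ (subsetP sF2 _ S'F2) (subsetP sF2 _ S0F2).
    rewrite !ffunE => tagE; have topE : top h i S' = top h i S0 := congr1 fst tagE.
    have X1 := congr1 (fun t => t.2.1) tagE; have X2 := congr1 (fun t => t.2.2) tagE.
    by rewrite /= topE in X1 X2; split.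
  set k := top h i S0 in top_eq *.
  pose e0 := e S0 S0 h i k.
  have e_top S' : S' \in F2 -> e S' S' h i (top h i S') = e0.
    by move=> /top_eq[-> E1 E2]; rewrite /e E1 E2.
  have w_k S' : S' \in F2 -> w S' h i k = 1.
    by move=> S'F2; rewrite -(w_top S' h i); case: (top_eq S' S'F2) => ->.
  have avgE S' T' : S' \in F2 -> T' \in F2 -> graph_attention (X S' T') (u h) W i c =
      weighted_avg (mix (d i) (w S' h i) (w T' h i)) (v h c).
    move=> S'F2 T'F2; rewrite graph_attentionE -(@weighted_avg_scale _ _ _ _ e0); last first.
      by rewrite gt_eqF ?expR_gt0.
    rewrite /weighted_avg; congr (_ / _); apply: eq_bigr => j _; [congr (_ * _)|];
      rewrite /mix !wE !e_top // /e ![X S' T' _ _]X_entry (d_sym j i);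
      by case: (d i j).
  rewrite !avgE //.
  have statD b o S' T' : S' \in F2 -> T' \in F2 ->
      `|stat (i, h, b, o) S' - stat (i, h, b, o) T'| <= delta.
    by move=> S'F2 T'F2; exact: statF2.
  have stat1 b S' : \sum_(j | d i j == b) w S' h i j = stat (i, h, b, None) S'.
    by apply: eq_bigr => j _; rewrite mulr1.
  have statM b S' : \sum_(j | d i j == b) w S' h i j * v h c j = M * stat (i, h, b, Some c) S'.
    rewrite mulr_sumr; apply: eq_bigr => j _ /=.
    by rewrite mulrCA [X in _ = _ * X]mulrC divfK ?gt_eqF.
  apply: (@mixed_avg_close _ _ _ _ _ _ _ _ k) => //.
  - by split; rewrite w_k.
  - by rewrite (stat1 true S) (stat1 true S0); exact: statD.
  - by rewrite (stat1 false T) (stat1 false S0); exact: statD.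
  - rewrite (statM true S) (statM true S0) -mulrBr normrM gtr0_norm // ler_pM2l //.
    exact: statD.
  - rewrite (statM false T) (statM false S0) -mulrBr normrM gtr0_norm // ler_pM2l //.
    exact: statD.
apply: le_lt_trans (ler_norm_sum _ _ _) _.
apply: (@le_lt_trans _ _ (\sum_(h < H) 4 * M * delta)).
  by apply: ler_sum => h _; exact: head_close.
rewrite sumr_const card_ord -[X in X < _]mulr_natl.
(* The choice of [cells] cancels [H], [m], [N] and [2 ^ (2 * p)], leaving a quarter of
   [2 ^ (- 2 * s)]. *)
have -> : H%:R * (4 * M * delta) = 1 / 2 ^+ s / 2 / 2 / 2 ^+ s.
  rewrite /delta /M /cells !natrM natrX mulnC exprM; field.
  by rewrite !expf_neq0 ?pnatr_eq0 -?lt0n ?m_gt0 ?H_gt0 ?N_gt0.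
have s1 : 1 <= 2 ^+ s :> R by rewrite exprn_ege1 // ler1n.
have s0 : 0 < 2 ^+ s :> R by rewrite exprn_gt0.
rewrite -[ltRHS]mulr1 -[ltLHS]mulrA ltr_pM2l ?divr_gt0 //.
by rewrite ltr_pdivrMr // mul1r; lra.
Qed.
End Attention.

(** The real embeddings [Y] still vary with [(S, T)]; only their rounding [Z] is common, so the
    induction quantifies over every [Y] that rounds to [Z]. *)
Lemma blocks_fooling (s : nat) (bs : seq (block R H m m)) :
  (forall i : 'I_(size bs), is_block p s (tnth (in_tuple bs) i)) ->
  forall (F : {set I}) (Z : 'M[R]_(N, m)), F != set0 -> fixed_point_mx p s Z ->
  exists (F' : {set I}) (Z' : 'M[R]_(N, m)),
    [/\ F' \subset F, (#|F| <= #|F'| * block_cost ^ size bs)%N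
      & {in F' &, forall S T Y, rounds_to_mx p s Y Z ->
          exists2 Y', blocks_run p s (X S T) bs Y Y' & rounds_to_mx p s Y' Z'}].
Proof.
elim: bs => [|b bs IH] ok F Z F0 fZ.
  by exists F, Z; split=> //=; [rewrite muln1 | move=> S T _ _ Y YZ; exists Y].
have [mlp_b heads_b] := ok ord0.
have fW : fixed_point_mx p s (apply_rows (block_mlp b) Z).
  by move=> i c; rewrite mxE; apply: mlp_b => k l; rewrite mxE.
have [F1 [Z1 [sF1 cF1 run1]]] := attention_fooling heads_b fW F0.
have F10 := nonempty_of_card F0 cF1; have [S0 S0F1] := set0Pn _ F10.
have fZ1 : fixed_point_mx p s Z1 by move=> i c; case: (run1 _ _ S0F1 S0F1 i c).
have [|F2 [Z2 [sF2 cF2 run2]]] := IH _ F1 Z1 F10 fZ1.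
  by move=> i; have := ok (lift ord0 i); rewrite !(tnth_nth b).
exists F2, Z2; split; first exact: subset_trans sF1.
  by apply: leq_trans cF1 _; rewrite expnSr mulnA leq_mul.
move=> S T SF2 TF2 Y YZ.
have := run1 _ _ (subsetP sF2 _ SF2) (subsetP sF2 _ TF2).
set Y1 := multihead_attention _ _ _ => Y1Z1.
have [Y2 run Y2Z2] := run2 _ _ SF2 TF2 _ Y1Z1.
by exists Y2 => //=; exists Y1 => //; exists Z.
Qed.

(** The first MLP reads an entire row of the adjacency matrix, so each row must be decided by a
    single index. *)
Hypothesis X_row : forall i,
  (forall S T j, X S T i j = X S S i j) \/ (forall S T j, X S T i j = X T T i j).

(** Each of the [N * m] entries is located in a cell of half a unit, which determines a [p]-bit
    number. *)
Definition input_cost : nat := ((2 ^ (p + 2)).+1 ^ (N * m))%N.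

Lemma input_fooling (s : nat) (phi : 'rV[R]_N -> 'rV[R]_m) (F : {set I}) :
  is_mlp p s phi -> F != set0 ->
  exists (F' : {set I}) (W : 'M[R]_(N, m)),
    [/\ F' \subset F, (#|F| <= #|F'| * input_cost)%N, fixed_point_mx p s W
      & {in F' &, forall S T,
          exists2 Z, rounds_to_mx p s (map_mx (fun b : bool => b%:R) (X S T)) Z
                   & apply_rows phi Z = W}].
Proof.
move=> mlp_phi F0.
have [r0 r0P] := rounds_to_total p s (0 : R).
have [r1 r1P] := rounds_to_total p s (1 : R).
(* 1 is not a [p]-bit number when [p <= s]. Rounding by the bit alone gives equal rows equal
   roundings. *)
pose Z S T : 'M[R]_N := map_mx (fun b : bool => if b then r1 else r0) (X S T).
pose Wf S T := apply_rows phi (Z S T).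
have ZP S T : rounds_to_mx p s (map_mx (fun b : bool => b%:R) (X S T)) (Z S T).
  by move=> i j; rewrite !mxE; case: (X S T i j).
have fW S T : fixed_point_mx p s (Wf S T).
  move=> i c; rewrite mxE; apply: mlp_phi => k j; rewrite mxE.
  by case: (ZP S T i j).
pose B : R := 2 ^+ p / 2 ^+ s.
have B0 : 0 < B by rewrite divr_gt0 // exprn_gt0.
have K0 : (0 < 2 ^ (p + 2))%N by rewrite expn_gt0.
have W_le (q : 'I_N * 'I_m) S : `|Wf S S q.1 q.2| <= B by apply: fixed_point_norm; exact: fW.
have [F1 [sF1 cF1 close]] := pigeonhole_real F B0 K0 W_le.
rewrite card_prod !card_ord in cF1.
have [S0 S0F1] := set0Pn _ (nonempty_of_card F0 cF1).
have W_const S : S \in F1 -> Wf S S = Wf S0 S0.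
  move=> SF1; apply/matrixP=> i c; apply: (fixed_point_sep (fW _ _ i c) (fW _ _ i c)).
  apply: le_lt_trans (close (i, c) _ _ SF1 S0F1) _.
  have p0 : 0 < 2 ^+ p :> R by rewrite exprn_gt0.
  have s0 : 0 < 2 ^+ s :> R by rewrite exprn_gt0.
  have -> : 2 * B / (2 ^ (p + 2))%:R = 1 / 2 ^+ s / 2.
    by rewrite /B natrX exprD; field; rewrite !gt_eqF.
  by rewrite ltr_pdivrMr // ltr_pMr ?ltr1n // divr_gt0.
exists F1, (Wf S0 S0); split=> // S T SF1 TF1; exists (Z S T) => //.
apply/row_matrixP => i; rewrite rowK.
have Zrow S' T' : (forall j, X S T i j = X S' T' i j) -> row i (Z S T) = row i (Z S' T').
  by move=> XE; apply/rowP => j; rewrite !mxE XE.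
case: (X_row i) => XE.
  by rewrite (Zrow S S) ?(W_const S SF1) // -(W_const S SF1) rowK.
by rewrite (Zrow T T) // -(W_const T TF1) rowK.
Qed.

Lemma transformer_fooling (D d' : nat) (f : 'M[bool]_N -> 'M[R]_(N, d')) (F : {set I}) :
  graph_transformer D H m p f -> F != set0 ->
  exists (F' : {set I}) (G : 'M[R]_(N, d')),
    (#|F| <= #|F'| * (input_cost * block_cost ^ D))%N /\
    {in F' &, forall S T, f (X S T) = G}.
Proof.
move=> [s [first [later [out [sz [mlp1 heads1] ok_later mlp_out fE]]]]] F0.
have [F1 [W [_ cF1 fW in1]]] := input_fooling mlp1 F0.
have F10 := nonempty_of_card F0 cF1.
have [F2 [Z2 [sF2 cF2 run2]]] := attention_fooling heads1 fW F10.
have F20 := nonempty_of_card F10 cF2; have [S0 S0F2] := set0Pn _ F20.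
have fZ2 : fixed_point_mx p s Z2 by move=> i c; case: (run2 _ _ S0F2 S0F2 i c).
have [F3 [Z3 [sF3 cF3 run3]]] := blocks_fooling ok_later F20 fZ2.
exists F3, (apply_rows out Z3); split.
  apply: leq_trans cF1 _; rewrite (mulnC input_cost) mulnA leq_mul // -sz expnSr mulnA.
  by apply: leq_trans cF2 _; rewrite leq_mul.
(* Every run on an input outputs [f], so exhibiting one run that ends in the common rounding [Z3]
   suffices. *)
move=> S T SF3 TF3; apply/esym/fE.
have [SF2 TF2] := (subsetP sF3 _ SF3, subsetP sF3 _ TF3).
have [Z0 XZ0 WE] := in1 _ _ (subsetP sF2 _ SF2) (subsetP sF2 _ TF2).
have := run2 _ _ SF2 TF2; set Y1 := multihead_attention _ _ _ => Y1Z2.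
have [YD runD YDZ] := run3 _ _ SF3 TF3 _ Y1Z2.
by exists Y1, YD, Z3; split=> //; exists Z0 => //; rewrite WE.
Qed.
End FoolingSet.

(** * The graph encoding non-inclusion of two sets *)

Section DisjointnessGraph.
Variables (n N : nat).
Implicit Types (S T : {set 'I_n * 'I_n}).

(* With u_k = k, v_l = n + l and w_k = 2n + k: the edges u_k -> v_l for (k, l) in S,
   v_l -> w_k for (k, l) not in T, and w_k -> u_k. *)
Definition edge S T (i j : nat) : bool :=
  [|| [exists q in S, (i == q.1 :> nat) && (j == n + q.2)%N],
      [exists q in ~: T, (i == n + q.2)%N && (j == n + n + q.1)%N]
    | [exists k : 'I_n, (i == n + n + k)%N && (j == k :> nat)]].

Definition disjointness_graph S T : 'M[bool]_N := \matrix_(i, j) edge S T i j.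

(** Edges depending on [S] have an endpoint among the [u_k], those depending on [T] have none, and
    the edges from [w_k] to [u_k] depend on neither. *)
Definition touches_u : rel 'I_N := fun i j => (i < n)%N || (j < n)%N.

Lemma touches_u_sym : symmetric touches_u.
Proof. by move=> i j; rewrite /touches_u orbC. Qed.

Lemma edge_l S T T' i j : (i < n)%N || (j < n)%N -> edge S T i j = edge S T' i j.
Proof.
move=> ij; rewrite /edge; congr [|| _, _ | _].
by apply/existsP/existsP => -[q /and3P[_ /eqP iE /eqP jE]]; move: ij; rewrite iE jE; lia.
Qed.

Lemma edge_r S S' T i j : (n <= i)%N -> edge S T i j = edge S' T i j.
Proof.
move=> ij; rewrite /edge; congr [|| _, _ | _].
apply/existsP/existsP => -[q /and3P[_ /eqP iE _]];
  by move: ij; rewrite iE leqNgt ltn_ord.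
Qed.

Lemma disjointness_graph_entry S T i j :
  disjointness_graph S T i j =
  if touches_u i j then disjointness_graph S S i j else disjointness_graph T T i j.
Proof.
rewrite !mxE /touches_u; case: ifP => [ij|/negbT]; first exact: edge_l.
by rewrite negb_or -leqNgt => /andP[ni _]; exact: edge_r.
Qed.

Lemma disjointness_graph_row i :
  (forall S T j, disjointness_graph S T i j = disjointness_graph S S i j) \/
  (forall S T j, disjointness_graph S T i j = disjointness_graph T T i j).
Proof.
have [ni|ni] := ltnP i n; [left|right] => S T j; rewrite !mxE.
  by apply: edge_l; rewrite ni.
exact: edge_r.
Qed.

(** From [u_k] the path must go to some [v_l] with [(k, l)] in [S], then to some [w_k'] with
    [(k', l)] not in [S]; returning to [u_k] forces [k' = k], a contradiction. *)
Lemma edge_no_cycle S (k : nat) j1 j2 :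
  (k < n)%N -> edge S S k j1 -> edge S S j1 j2 -> edge S S j2 k -> False.
Proof.
move=> kn /or3P[] /existsP[q]; last 1 first.
- by case/andP=> /eqP kE _; move: kn; rewrite kE; lia.
- case/and3P=> qS /eqP kE /eqP j1E.
  case/or3P=> /existsP[q'].
  + by case/and3P=> _ /eqP j1E' _; have := ltn_ord q'.1; lia.
  + case/and3P=> q'S /eqP j1E' /eqP j2E.
    case/or3P=> /existsP[q''].
    * by case/and3P=> _ /eqP j2E' _; have := ltn_ord q''.1; lia.
    * by case/and3P=> _ /eqP j2E' _; have := ltn_ord q''.2; lia.
    * case/andP=> /eqP j2E' /eqP kE'.
      suff qq' : q = q' by rewrite -qq' inE qS in q'S.
      by rewrite [q]surjective_pairing [q']surjective_pairing;
        congr pair; apply: ord_inj; lia.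
  + by case/andP=> /eqP j1E' _; have := ltn_ord q.2; lia.
by case/and3P=> _ /eqP kE _; move: kn; rewrite kE; lia.
Qed.

Lemma disjointness_graph_cycle (R : realType) S T q :
  (n + n + n <= N)%N -> q \in S -> q \notin T ->
  directed_cycle3 R (disjointness_graph S T) != directed_cycle3 R (disjointness_graph S S).
Proof.
move=> nN qS qT; case: q => [k l] in qS qT *.
have [kn ln] := (ltn_ord k, ltn_ord l).
have ltu : (k < N)%N by lia.
have ltv : (n + l < N)%N by lia.
have ltw : (n + n + k < N)%N by lia.
(* The outputs differ at [u_k]: with [T] there is the cycle [u_k], [v_l], [w_k]. *)
apply/eqP => /matrixP/(_ (Ordinal ltu) ord0).
rewrite /directed_cycle3 ![(\col__ _) _ _]mxE.
have -> : [exists j1, exists j2, [&& disjointness_graph S T (Ordinal ltu) j1,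
    disjointness_graph S T j1 j2 & disjointness_graph S T j2 (Ordinal ltu)]].
  apply/existsP; exists (Ordinal ltv); apply/existsP; exists (Ordinal ltw).
  rewrite !mxE; apply/and3P; split; apply/or3P.
  - by apply: Or31; apply/existsP; exists (k, l); rewrite qS !eqxx.
  - by apply: Or32; apply/existsP; exists (k, l); rewrite inE qT !eqxx.
  - by apply: Or33; apply/existsP; exists k; rewrite !eqxx.
case: existsP => [[j1 /existsP[j2]]|_ /eqP]; last by rewrite oner_eq0.
by rewrite !mxE => /and3P[e1 e2 e3] _; exact: edge_no_cycle e1 e2 e3.
Qed.

End DisjointnessGraph.

(** * Counting and the final bound *)

Lemma cost_le (p N m H D t : nat) :
  (0 < m)%N -> (0 < p)%N -> (0 < H)%N -> (0 < D)%N -> (0 < t)%N ->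
  (N < 2 ^ t.+1)%N -> (m * H <= N)%N ->
  (input_cost p N m * block_cost p N m H ^ D <= 2 ^ (56 * N * t * (m * p * H * D)))%N.
Proof.
move=> m0 p0 H0 D0 t0 Nt mHN.
have N0 : (0 < N)%N by apply: leq_trans mHN; rewrite muln_gt0 m0.
have input_le : (input_cost p N m <= 2 ^ ((p + 3) * (N * m)))%N.
  rewrite /input_cost (expnM 2) leq_exp2r ?muln_gt0 ?N0 //.
  by rewrite ltn_exp2l // ltn_add2l.
have tag_le : ((N * (2 * 2)) ^ (N * H) <= 2 ^ ((t + 3) * (N * H)))%N.
  rewrite (expnM 2) leq_exp2r ?muln_gt0 ?N0 //.
  have -> : (t + 3 = t.+1 + 2)%N by lia.
  by rewrite expnD leq_mul // ltnW.
(* The assumption [m * H <= N] keeps the logarithm of [cells] in [O(p + t)]. *)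
have cells_le : (cells p N m H <= 2 ^ (7 + 2 * p + 2 * t))%N.
  rewrite /cells -(mulnA 32) -(mulnA 32).
  have -> : (7 + 2 * p + 2 * t = 5 + (t.+1 + t.+1) + 2 * p)%N by lia.
  rewrite !expnD; apply: leq_mul => //; apply: leq_mul => //.
  by apply: leq_mul; [apply: leq_trans mHN _|]; exact: ltnW.
have stat_le : ((cells p N m H).+1 ^ (N * H * 2 * m.+1) <=
    2 ^ ((8 + 2 * p + 2 * t) * (N * H * 2 * m.+1)))%N.
  rewrite (expnM 2) leq_exp2r ?muln_gt0 ?N0 ?H0 //.
  by apply: leq_ltn_trans cells_le _; rewrite ltn_exp2l.
have block_le : (block_cost p N m H <=
    2 ^ ((t + 3) * (N * H) + (8 + 2 * p + 2 * t) * (N * H * 2 * m.+1)))%N.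
  by rewrite expnD leq_mul.
apply: leq_trans (leq_mul input_le (_ : _ <= 2 ^ (_ * D))%N) _.
  by rewrite (expnM 2) leq_exp2r //; exact: block_le.
(* The constant splits as 56 = 4 + 4 + 48: input, tags, partial sums. *)
rewrite -expnD leq_exp2l //.
have E1 : ((p + 3) * (N * m) <= 4 * (N * t * (m * p * H * D)))%N.
  have -> : (4 * (N * t * (m * p * H * D)) = (4 * p) * (N * m) * (t * H * D))%N by ring.
  by rewrite -[leqLHS]muln1 !leq_mul ?muln_gt0 ?t0 ?H0 //; lia.
have E2 : ((t + 3) * (N * H) * D <= 4 * (N * t * (m * p * H * D)))%N.
  have -> : (4 * (N * t * (m * p * H * D)) = (4 * t) * (N * H) * D * (m * p))%N by ring.
  by rewrite -[leqLHS]muln1 !leq_mul ?muln_gt0 ?m0 //; lia.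
have E3 : ((8 + 2 * p + 2 * t) * (N * H * 2 * m.+1) * D <= 48 * (N * t * (m * p * H * D)))%N.
  have -> : (48 * (N * t * (m * p * H * D)) = (12 * (p * t)) * (N * H * 2 * (2 * m)) * D)%N by ring.
  rewrite !leq_mul //; last by lia.
  have ppt : (p <= p * t)%N by rewrite leq_pmulr.
  have tpt : (t <= p * t)%N by rewrite leq_pmull.
  by clear -ppt tpt p0; lia.
by rewrite mulnDl; lia.
Qed.

Lemma transformer_lower_bound (R : realType) (N m p H D : nat)
    (f : 'M[bool]_N -> 'M[R]_(N, 1)) :
  (8 <= N)%N -> (0 < m)%N -> (0 < p)%N -> (0 < H)%N -> (0 < D)%N ->
  graph_transformer D H m p f -> (forall X, f X = directed_cycle3 R X) ->
  (N <= 896 * (trunc_log 2 N * (m * p * H * D)))%N.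
Proof.
move=> N8 m0 p0 H0 D0 gt_f fE; set t := trunc_log 2 N.
have t0 : (0 < t)%N by rewrite trunc_log_gt0; lia.
(* If [m * H] exceeds [N], the bound is immediate. *)
have [mHN|/ltnW NmH] := leqP (m * H) N; last first.
  apply: leq_trans NmH _.
  have -> : (896 * (t * (m * p * H * D)) = m * H * (896 * (t * p * D)))%N by ring.
  by rewrite -[leqLHS]muln1 leq_mul // !muln_gt0 t0 p0.
have [n nN Nn] : exists2 n, (n + n + n <= N)%N & (N <= 4 * n)%N.
  by exists (N %/ 3)%N; lia.
have N0 : (0 < N)%N by lia.
have F0 : [set: {set 'I_n * 'I_n}] != set0 by apply/set0Pn; exists set0; rewrite inE.
have [F' [G [cF' fG]]] := transformer_fooling m0 H0 N0
  (@touches_u_sym n N) (@disjointness_graph_entry n N)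
  (@disjointness_graph_row n N) gt_f F0.
(* An element of one set missing from the other would give different outputs on two inputs where [f]
   equals [G]. *)
have F'1 : (#|F'| <= 1)%N.
  apply/card_le1_eqP => S T SF' TF'; apply/eqP; rewrite eqEsubset.
  by apply/andP; split; apply/subsetP => q q_in; apply: contraT => q_notin;
    have := disjointness_graph_cycle R nN q_in q_notin; rewrite -!fE !fG ?eqxx.
have Nt : (N < 2 ^ t.+1)%N by exact: trunc_log_ltn.
have := leq_trans cF' (leq_mul F'1 (cost_le m0 p0 H0 D0 t0 Nt mHN)).
rewrite mul1n -powersetT card_powerset cardsT card_prod !card_ord leq_exp2l // => nE.
(* 896 = 16 * 56, from [N * N <= 16 * (n * n)]. *)
rewrite -(leq_pmul2l N0); apply: leq_trans (leq_mul Nn Nn) _; nia.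
Qed.

Theorem theorem23 (R : realType) :
  exists (c : R) (N0 : nat), 0 < c /\
    forall (N m p H D : nat) (f : 'M[bool]_N -> 'M[R]_(N, 1)),
      (N0 <= N)%N -> (0 < m)%N -> (0 < p)%N -> (0 < H)%N -> (0 < D)%N ->
      graph_transformer D H m p f ->
      (forall X : 'M[bool]_N, f X = directed_cycle3 R X) ->
      c * N%:R / (ln (N%:R : R)) ^+ 2 <= (m * p * H * D)%:R.
Proof.
have ln2 : 0 < ln 2 :> R by rewrite ln_gt0 // ltr1n.
(* The factor [ln 2 ^+ 2] converts the binary logarithm [t] into [ln N], through
   [t * ln 2 <= ln N]. *)
exists (ln 2 ^+ 2 / 896), 8; split; first by rewrite divr_gt0 // exprn_gt0.
move=> N m p H D f N8 m0 p0 H0 D0 gt_f fE.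
have := transformer_lower_bound N8 m0 p0 H0 D0 gt_f fE.
set t := trunc_log 2 N; set C := (m * p * H * D)%N => NtC.
have t0 : (0 < t)%N by rewrite trunc_log_gt0; lia.
have lnN : t%:R * ln 2 <= ln N%:R :> R.
  rewrite mulr_natl -lnXn // ler_ln ?posrE ?exprn_gt0 // ?ltr0n; last by lia.
  by rewrite -natrX ler_nat trunc_logP //; lia.
have tln0 : 0 < t%:R * ln 2 :> R by rewrite mulr_gt0 // ltr0n.
have lnN0 := lt_le_trans tln0 lnN; rewrite ler_pdivrMr ?exprn_gt0 //.
apply: (@le_trans _ _ (C%:R * (t%:R * ln 2) ^+ 2)); last first.
  by rewrite ler_wpM2l ?ler0n // lerXn2r // nnegrE ltW.
have -> : ln 2 ^+ 2 / 896 * N%:R = N%:R / 896 * ln 2 ^+ 2 :> R by field.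
rewrite exprMn [leRHS]mulrA ler_wpM2r ?exprn_ge0 ?(ltW ln2) // ler_pdivrMr ?ltr0n //.
rewrite -!natrX -!natrM ler_nat; apply: leq_trans NtC _.
(* Here [t] is relaxed to its square. *)
by rewrite mulnC leq_mul // mulnC leq_mul // leq_pmulr.
Qed.
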